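(* Let $N\in\mathbb N^*=\{1,2,3,\dots\}\cup\{\infty\}$, let $(\mu_j)_{j=1}^N$ be points of the open unit disc $\mathbb D\subset\mathbb C$ (a finite list if $N<\infty$, an infinite sequence $\mu_1,\mu_2,\dots$ if $N=\infty$), let $p=\prod_{j=1}^N|\mu_j|$, and let $q\in(p,1)$. Then there exist a holomorphic map $f:\mathbb D\to\mathbb D$ and points $(\eta_j)_{j=1}^N$ of $\mathbb D$ such that $\prod_{j=1}^N|\eta_j|=q$, $f(0)=0$, and $f(\eta_j)=\mu_j$ for every $j$.
   Context: $\mathbb D$ is the open unit disc in $\mathbb C$. For $N=\infty$ the products are limits of the (non-increasing) partial products; the value $0$ is allowed. *)

(* Defs.v *)
From Stdlib Require Import Reals.
From Coquelicot Require Import Coquelicot.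

Open Scope R_scope.

Inductive natbar : Set :=
| nfin (n : nat)
| ninf.

Definition le_natbar (j : nat) (N : natbar) : Prop :=
  match N with
  | nfin n => (j <= n)%nat
  | ninf => True
  end.

(* A family (a_j)_{j=1}^N is encoded as a : nat -> C; only the values of a at
   the indices below are meaningful (in particular a 0 never is). *)
Definition is_index (N : natbar) (j : nat) : Prop :=
  (1 <= j)%nat /\ le_natbar j N.

Definition in_disc (z : C) : Prop := Cmod z < 1.

(* prod_f_R0 u m is the product of the m+1 factors u 0, ..., u m, so this is
   |a_1| * ... * |a_(m+1)|. *)
Definition partial_mod_prod (a : nat -> C) (m : nat) : R :=
  prod_f_R0 (fun k => Cmod (a (S k))) m.

(* p = prod_{j=1}^N |a_j|, for N >= 1.  For N infinite this is the convergence
   of the partial products to p, the limit 0 being allowed. *)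
Definition is_mod_prod (N : natbar) (a : nat -> C) (p : R) : Prop :=
  match N with
  | nfin n => p = partial_mod_prod a (pred n)
  | ninf => is_lim_seq (partial_mod_prod a) (Finite p)
  end.

(* f is a total function on C whose values off the disc are irrelevant: the
   disc is open, so complex differentiability at its points is local. *)
Definition holomorphic_on_disc (f : C -> C) : Prop :=
  forall z : C, in_disc z -> @ex_derive C_AbsRing C_NormedModule f z.

Definition holomorphic_self_map_of_disc (f : C -> C) : Prop :=
  holomorphic_on_disc f /\ (forall z : C, in_disc z -> in_disc (f z)).

(* Main.v *)
Require Import Defs.
From Stdlib Require Import Classical IndefiniteDescription Reals Lra Lia Psatz.
From Coquelicot Require Import Coquelicot.

(** Say that f lifts the family (eta_j) to (mu_j) when f is a holomorphic self-map
    of the disc with f(0) = 0 and f(eta_j) = mu_j for all j.  Composing such maps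
    composes lifts, so the points mu_j may be replaced, several times, by points
    further out, as long as the product of the moduli stays below q until the
    last step.  Three kinds of replacement are made.

    If some mu_j vanishes, the map b_a(z) = z (z + a) / (1 + a z) with a small has
    the second zero -a.  Using it as the preimage of 0 gives a family without
    zeros, whose product of moduli is at most a < q ([lift_to_nonzero]).

    If no mu_j vanishes but the product may be 0, it is made positive and kept
    below q ([lift_to_positive]).  Let c = e^{-t} and let F_t be the universal
    covering of the disc punctured at c, normalised by F_t(0) = 0.  It takes every
    value other than c at points arbitrarily close to the circle, and as t tends
    to 0 the puncture moves to the boundary and F_t tends to the identity.  A
    finite part of the product of the |mu_j| is already below q.  For t small the
    corresponding points have preimages of almost the same modulus
    ([punctured_cover_small_time]), and the remaining ones are lifted so close to
    the circle that their product is positive ([punctured_cover_near_boundary]).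
    Only countably many t have e^{-t} among the mu_j, and they are avoided
    ([avoid_sequence]).

    If the product p is positive, the maps b_a interpolate between the identity
    (a = 1) and the square (a = 0).  The smaller solution of b_a(z) = mu has
    modulus between |mu| and 1, given by an explicit continuous function of a that
    goes from |mu| to sqrt |mu|.  As p > 0 the infinite product of these moduli is
    continuous in a, and the intermediate value theorem reaches every q in
    (p, sqrt p] ([raise_to_sqrt]).  For larger q, first take square roots of the
    points until the product p satisfies q <= sqrt p ([attainable_of_pos]).

    Finite and infinite lists are treated together: a family is indexed by nat, a
    boolean mask tells which indices count, and the others contribute the factor
    1 to the product. *)

(** * Complex differentiability *)

(** In the filter form of differentiability the domain and the codomain of a map
    C -> C carry two different uniform structures; the epsilon-delta form involves
    neither. *)
Lemma is_Cderive_intro (f : C -> C) (z l : C) :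
  (forall eps : R, 0 < eps -> exists delta : R, 0 < delta /\
     forall h : C, Cmod h < delta ->
       Cmod (f (z + h) - f z - h * l)%C <= eps * Cmod h) ->
  @is_derive C_AbsRing C_NormedModule f z l.
Proof.
  intros H; split.
  - apply is_linear_scal_l.
  - intros x Hx eps.
    assert (x = z) as ->.
    { symmetry. apply (is_filter_lim_locally_unique (V := AbsRing_NormedModule C_AbsRing)). exact Hx. }
    destruct (H eps (cond_pos eps)) as [d [Hd Hb]].
    exists (mkposreal d Hd). intros y Hy. change C in (type of y).
    specialize (Hb (y - z)%C Hy).
    replace (z + (y - z))%C with y in Hb by (change (y = z + (y - z))%C; ring).
    exact Hb.
Qed.

(** The two normed module structures on C differ only in their uniform structure,
    which the derivative at a point sees through the norm alone.  In the second one
    C is a module over itself, as the factors of a product and the inner function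
    of a composition have to be. *)
Lemma is_Cderive_ring (f : C -> C) (z l : C) :
  @is_derive C_AbsRing C_NormedModule f z l <->
  @is_derive C_AbsRing (AbsRing_NormedModule C_AbsRing) f z l.
Proof.
  split; intros [_ H]; (split; [apply is_linear_scal_l | exact H]).
Qed.

Lemma ex_Cderive_mult (f g : C -> C) (z : C) :
  @ex_derive C_AbsRing C_NormedModule f z ->
  @ex_derive C_AbsRing C_NormedModule g z ->
  @ex_derive C_AbsRing C_NormedModule (fun x => f x * g x)%C z.
Proof.
  intros [df Hf%is_Cderive_ring] [dg Hg%is_Cderive_ring]. eexists.
  apply is_Cderive_ring.
  apply (@is_derive_mult C_AbsRing f g z df dg Hf Hg). exact Cmult_comm.
Qed.

Lemma ex_Cderive_comp (f g : C -> C) (z : C) :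
  @ex_derive C_AbsRing C_NormedModule f (g z) ->
  @ex_derive C_AbsRing C_NormedModule g z ->
  @ex_derive C_AbsRing C_NormedModule (fun x => f (g x)) z.
Proof.
  intros [df Hf] [dg Hg%is_Cderive_ring]. eexists.
  apply (@is_derive_comp C_AbsRing C_NormedModule f g z df dg Hf Hg).
Qed.

Lemma ex_Cderive_affine (a b : C) (f : C -> C) (z : C) : (forall x, f x = a + b * x)%C ->
  @ex_derive C_AbsRing C_NormedModule f z.
Proof.
  intros Hf. exists b. apply is_Cderive_intro. intros eps Heps. exists 1; split; [lra|].
  intros h _. rewrite !Hf.
  replace (a + b * (z + h) - (a + b * z) - h * b)%C with (RtoC 0) by ring.
  rewrite Cmod_0. pose proof (Cmod_ge_0 h). nra.
Qed.

Lemma ex_Cderive_inv (z : C) : z <> 0%C ->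
  @ex_derive C_AbsRing C_NormedModule Cinv z.
Proof.
  intros Hz. exists (- / (z * z))%C.
  apply is_Cderive_intro. intros eps Heps.
  assert (Hm : 0 < Cmod z) by now apply Cmod_gt_0.
  set (m := Cmod z) in *.
  exists (Rmin (m / 2) (eps * m ^ 3 / 2)); split.
  { apply Rmin_glb_lt; [lra|]. pose proof (pow_lt m 3 Hm). nra. }
  intros h Hh.
  assert (H1 : Cmod h < m / 2) by (eapply Rlt_le_trans; [exact Hh | apply Rmin_l]).
  assert (H2 : Cmod h < eps * m ^ 3 / 2) by (eapply Rlt_le_trans; [exact Hh | apply Rmin_r]).
  assert (H3 : m / 2 <= Cmod (z + h)).
  { pose proof (Cmod_triangle (z + h) (- h)) as T.
    replace (z + h + - h)%C with z in T by ring.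
    rewrite Cmod_opp in T. fold m in T. lra. }
  assert (Hzh : (z + h)%C <> 0%C) by (apply Cmod_gt_0; lra).
  replace (/ (z + h) - / z - h * - / (z * z))%C with (h * (h / (z * z * (z + h))))%C
    by (field; split; assumption).
  rewrite Cmod_mult, Rmult_comm.
  apply Rmult_le_compat_r; [apply Cmod_ge_0|].
  rewrite Cmod_div by (repeat apply Cmult_neq_0; assumption).
  rewrite !Cmod_mult. fold m.
  apply Rle_div_l; [pose proof (Rmult_lt_0_compat m m Hm Hm); nra|].
  assert (0 <= eps * (m * m)) by nra.
  assert (eps * (m * m) * (m / 2) <= eps * (m * m) * Cmod (z + h))
    by (apply Rmult_le_compat_l; assumption).
  nra.
Qed.

Lemma ex_Cderive_div (f g : C -> C) (z : C) :
  @ex_derive C_AbsRing C_NormedModule f z ->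
  @ex_derive C_AbsRing C_NormedModule g z -> g z <> 0%C ->
  @ex_derive C_AbsRing C_NormedModule (fun x => f x / g x)%C z.
Proof.
  intros Hf Hg H0. unfold Cdiv. apply ex_Cderive_mult; [exact Hf|].
  apply (ex_Cderive_comp Cinv); [now apply ex_Cderive_inv | exact Hg].
Qed.

(** * The complex exponential *)

Definition Cexp (z : C) : C := (exp (Re z) * cos (Im z), exp (Re z) * sin (Im z)).

Lemma Cexp_plus (z w : C) : Cexp (z + w) = (Cexp z * Cexp w)%C.
Proof.
  destruct z as [x y], w as [u v]. unfold Cexp, Cmult, Cplus; simpl.
  rewrite exp_plus, cos_plus, sin_plus. f_equal; ring.
Qed.

Lemma Cmod_Cexp (z : C) : Cmod (Cexp z) = exp (Re z).
Proof.
  unfold Cmod, Cexp; simpl.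
  pose proof (sin2_cos2 (Im z)) as H. unfold Rsqr in H.
  replace (_ + _) with (exp (Re z) ^ 2) by (simpl; nra).
  apply sqrt_pow2. left; apply exp_pos.
Qed.

Lemma Cexp_neq_0 (z : C) : Cexp z <> 0%C.
Proof. apply Cmod_gt_0. rewrite Cmod_Cexp. apply exp_pos. Qed.

Lemma Cexp_periodic (L : C) (n : nat) : Cexp (Re L, Im L + 2 * INR n * PI) = Cexp L.
Proof. unfold Cexp; simpl. now rewrite cos_period, sin_period. Qed.

Lemma real_derive_0 (f : R -> R) (l : R) : is_derive f 0 l ->
  forall eps, 0 < eps -> exists d, 0 < d /\
    forall x, Rabs x < d -> Rabs (f x - f 0 - x * l) <= eps * Rabs x.
Proof.
  intros [_ H] eps Heps.
  destruct (H 0 (fun P HP => HP) (mkposreal _ Heps)) as [d Hd].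
  exists d; split; [apply cond_pos|]. intros x Hx.
  assert (Hb : ball 0 d x) by (unfold ball; simpl; unfold AbsRing_ball, abs, minus, plus, opp; simpl;
    replace (x + - 0) with x by ring; exact Hx).
  specialize (Hd x Hb). simpl in Hd. unfold norm, minus, plus, opp, scal in Hd; simpl in Hd.
  unfold abs, mult in Hd; simpl in Hd.
  replace (f x - f 0 - x * l) with (f x + - f 0 + - ((x + - 0) * l)) by ring.
  replace (Rabs x) with (Rabs (x + - 0)) by (f_equal; ring). exact Hd.
Qed.

(** By the addition law it is enough to estimate exp(h) - 1 - h, which follows from
    the derivatives at 0 of the real functions exp, cos and sin. *)
Lemma ex_Cderive_exp (z : C) : @ex_derive C_AbsRing C_NormedModule Cexp z.
Proof.
  exists (Cexp z). apply is_Cderive_intro. intros eps Heps.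
  set (M := Cmod (Cexp z)).
  assert (HM : 0 < M) by (apply Cmod_gt_0, Cexp_neq_0).
  set (e := Rmin 1 (eps / (8 * M))).
  assert (He : 0 < e) by (apply Rmin_glb_lt; [lra|]; apply Rdiv_lt_0_compat; lra).
  assert (He1 : e <= 1) by apply Rmin_l.
  assert (He2 : 8 * M * e <= eps).
  { assert (e <= eps / (8 * M)) by apply Rmin_r. 
    replace eps with (8 * M * (eps / (8 * M))) by (field; lra). nra. }
  assert (De : is_derive exp 0 1) by (auto_derive; [trivial | rewrite exp_0; ring]).
  assert (Dc : is_derive cos 0 0) by (auto_derive; [trivial | rewrite sin_0; ring]).
  assert (Ds : is_derive sin 0 1) by (auto_derive; [trivial | rewrite cos_0; ring]).
  destruct (real_derive_0 _ _ De e He) as [d1 [Hd1 E1]].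
  destruct (real_derive_0 _ _ Dc e He) as [d2 [Hd2 E2]].
  destruct (real_derive_0 _ _ Ds e He) as [d3 [Hd3 E3]].
  exists (Rmin (Rmin d1 d2) (Rmin d3 (e / 2))); split.
  { repeat apply Rmin_glb_lt; lra. }
  intros h Hh.
  replace (Cexp (z + h) - Cexp z - h * Cexp z)%C with (Cexp z * (Cexp h - 1 - h))%C
    by (rewrite Cexp_plus; ring).
  rewrite Cmod_mult. fold M.
  assert (Hr : Rabs (Re h) <= Cmod h) by apply re_le_Cmod.
  assert (Hi : Rabs (Im h) <= Cmod h).
  { eapply Rle_trans; [apply Rmax_r | apply (Rmax_Cmod h)]. }
  pose proof (Rmin_l (Rmin d1 d2) (Rmin d3 (e / 2))).
  pose proof (Rmin_r (Rmin d1 d2) (Rmin d3 (e / 2))).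
  pose proof (Rmin_l d1 d2). pose proof (Rmin_r d1 d2).
  pose proof (Rmin_l d3 (e / 2)). pose proof (Rmin_r d3 (e / 2)).
  specialize (E1 (Re h) ltac:(lra)). specialize (E2 (Im h) ltac:(lra)).
  specialize (E3 (Im h) ltac:(lra)).
  rewrite exp_0 in E1. rewrite cos_0 in E2. rewrite sin_0 in E3.
  set (x := Re h) in *. set (y := Im h) in *. set (k := Cmod h) in *.
  assert (B1 : Rabs (exp x * cos y - 1 - x) <= 3 * e * k).
  { replace (exp x * cos y - 1 - x)
      with ((exp x - 1 - x * 1) * cos y + (1 + x) * (cos y - 1 - y * 0)) by ring.
    eapply Rle_trans; [apply Rabs_triang|]. rewrite !Rabs_mult.
    pose proof (COS_bound y).
    assert (Rabs (cos y) <= 1) by (apply Rabs_le; lra).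
    assert (Rabs (1 + x) <= 2).
    { eapply Rle_trans; [apply Rabs_triang|]. rewrite Rabs_R1. lra. }
    pose proof (Rabs_pos (exp x - 1 - x * 1)).
    pose proof (Rabs_pos (cos y - 1 - y * 0)).
    nra. }
  assert (B2 : Rabs (exp x * sin y - y) <= 5 * e * k).
  { replace (exp x * sin y - y)
      with (exp x * (sin y - 0 - y * 1) + ((exp x - 1 - x * 1) + x) * y) by ring.
    eapply Rle_trans; [apply Rabs_triang|]. rewrite !Rabs_mult.
    assert (Rabs (exp x - 1 - x * 1 + x) <= e).
    { eapply Rle_trans; [apply Rabs_triang|]. nra. }
    assert (Rabs (exp x) <= 3).
    { replace (exp x) with ((exp x - 1 - x * 1 + x) + 1) by ring.
      eapply Rle_trans; [apply Rabs_triang|]. rewrite Rabs_R1. lra. }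
    pose proof (Rabs_pos (sin y - 0 - y * 1)).
    pose proof (Rabs_pos (exp x)). pose proof (Rabs_pos y).
    pose proof (Rabs_pos (exp x - 1 - x * 1 + x)). nra. }
  assert (B3 : Cmod (Cexp h - 1 - h) <= 8 * e * k).
  { replace (Cexp h - 1 - h)%C
      with ((exp x * cos y - 1 - x)%R + Ci * (exp x * sin y - y)%R)%C.
    - eapply Rle_trans; [apply Cmod_triangle|].
      rewrite Cmod_mult, Cmod_Ci, !Cmod_R. lra.
    - unfold Cexp, x, y, RtoC, Ci, Cminus, Cplus, Cmult, Copp; destruct h; simpl.
      f_equal; ring. }
  assert (0 <= k) by apply Cmod_ge_0.
  nra.
Qed.

Lemma Cexp_surj (z : C) : z <> 0%C -> exists L : C, Cexp L = z.
Proof.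
  intros Hz. assert (Hm : 0 < Cmod z) by now apply Cmod_gt_0.
  pose proof (Cmod2_alt z) as Hsq.
  set (m := Cmod z) in *. set (x := Re z / m). set (y := Im z / m).
  assert (Hxy : x ^ 2 + y ^ 2 = 1).
  { unfold x, y. apply (Rmult_eq_reg_r (m ^ 2)); [|nra]. field_simplify; lra. }
  assert (Hx : -1 <= x <= 1) by nra.
  assert (exists t, cos t = x /\ sin t = y) as [t [Hc Hs]].
  { assert (Hsa : sin (acos x) = Rabs y).
    { rewrite sin_acos by exact Hx. rewrite <- sqrt_Rsqr_abs. f_equal. unfold Rsqr; lra. }
    destruct (Rle_lt_dec 0 y).
    - exists (acos x). rewrite cos_acos by exact Hx. rewrite Hsa, Rabs_right by lra. tauto.
    - exists (- acos x). rewrite cos_neg, cos_acos by exact Hx.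
      rewrite sin_neg, Hsa, Rabs_left by lra. split; ring. }
  exists (ln m, t). unfold Cexp; simpl. rewrite exp_ln, Hc, Hs by exact Hm.
  unfold x, y. destruct z as [a b]; simpl. f_equal; field; lra.
Qed.

Lemma Csqrt_exists (z : C) : exists w : C, (w * w)%C = z.
Proof.
  destruct (Ceq_dec z 0) as [->|Hz]; [exists 0%C; ring|].
  destruct (Cexp_surj z Hz) as [L HL]. exists (Cexp (L / 2)).
  rewrite <- Cexp_plus, <- HL. f_equal. field.
Qed.

(** The principal logarithm; on the right half-plane the argument is an arctangent,
    which makes its dependence on a parameter a matter of real calculus. *)
Definition half_plane_log (z : C) : C := (ln (Re z ^ 2 + Im z ^ 2) / 2, atan (Im z / Re z)).

Lemma Cexp_half_plane_log (z : C) : 0 < Re z -> Cexp (half_plane_log z) = z.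
Proof.
  destruct z as [x y]. unfold half_plane_log, Cexp, Re, Im; cbn [fst snd]. intros Hx.
  assert (Hm : 0 < x ^ 2 + y ^ 2) by nra.
  assert (E1 : exp (ln (x ^ 2 + y ^ 2) / 2) = sqrt (x ^ 2 + y ^ 2)).
  { rewrite <- Rpower_sqrt by exact Hm. unfold Rpower. f_equal. field. }
  assert (E2 : sqrt (1 + (y / x)²) = sqrt (x ^ 2 + y ^ 2) / x).
  { replace (1 + (y / x)²) with ((x ^ 2 + y ^ 2) / x ^ 2) by (unfold Rsqr; field; lra).
    rewrite sqrt_div_alt, sqrt_pow2 by nra. reflexivity. }
  assert (0 < sqrt (x ^ 2 + y ^ 2)) by now apply sqrt_lt_R0.
  rewrite E1, cos_atan, sin_atan, E2. f_equal; field; lra.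
Qed.

(** * Countable sets of reals *)

(** Nested intervals, the n-th step excluding the n-th term of the sequence. *)
Lemma avoid_sequence (s : nat -> R) (T : R) : 0 < T -> exists t, 0 < t < T /\ forall n, t <> s n.
Proof.
  intros HT.
  (* The half not containing s n, shrunk when it is the left one so that s n
     is not an endpoint of it. *)
  set (next := fun n (I : R * R) => let m := (fst I + snd I) / 2 in
    if Rlt_dec (s n) m then (m, snd I) else (fst I, (fst I + m) / 2)).
  set (I := nat_rect (fun _ => (R * R)%type) (T / 3, 2 * T / 3) next).
  assert (HS : forall n, I (S n) = next n (I n)) by reflexivity.
  assert (Hlt : forall n, fst (I n) < snd (I n)).
  { induction n as [|n IH]; [simpl; lra|]. rewrite HS. unfold next.
    destruct Rlt_dec; simpl; lra. }
  assert (Hstep : forall n, fst (I n) <= fst (I (S n)) /\ snd (I (S n)) <= snd (I n) /\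
                    (s n < fst (I (S n)) \/ snd (I (S n)) < s n)).
  { intros n. rewrite HS. specialize (Hlt n). unfold next. destruct Rlt_dec; simpl; lra. }
  assert (Hmono : forall n m, (n <= m)%nat -> fst (I n) <= fst (I m) /\ snd (I m) <= snd (I n)).
  { intros n m H. induction H as [|m H IH]; [lra|]. destruct (Hstep m) as [? [? _]]. lra. }
  destruct (ex_finite_lim_seq_incr (fun n => fst (I n)) (snd (I 0%nat))) as [x Hx].
  - intros n. apply Hstep.
  - intros n. pose proof (Hlt n). destruct (Hmono 0%nat n) as [_ ?]; [lia|]. lra.
  - assert (Hlow : forall n, fst (I n) <= x).
    { apply (is_lim_seq_incr_compare _ x Hx). intros n. apply Hstep. }
    assert (Hup : forall n, x <= snd (I n)).
    { intros n. apply (is_lim_seq_le_loc (fun n => fst (I n)) (fun _ => snd (I n)) x (snd (I n))).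
      - exists n. intros m Hm. pose proof (Hlt m). destruct (Hmono n m Hm). lra.
      - exact Hx.
      - apply is_lim_seq_const. }
    exists x. split.
    + pose proof (Hlow 0%nat). pose proof (Hup 0%nat). simpl in *. lra.
    + intros n ->. destruct (Hstep n) as [_ [_ H]].
      pose proof (Hlow (S n)). pose proof (Hup (S n)). lra.
Qed.

(** * Infinite products of numbers in the unit interval *)

Lemma prod_S (u : nat -> R) (n : nat) : prod_f_R0 u (S n) = prod_f_R0 u n * u (S n).
Proof. reflexivity. Qed.

Lemma prod_ext (u v : nat -> R) (n : nat) : (forall k, u k = v k) -> prod_f_R0 u n = prod_f_R0 v n.
Proof. intros H. induction n as [|n IH]; simpl; [apply H|]. now rewrite IH, H. Qed.

Lemma prod_unit_interval (u : nat -> R) (n : nat) : (forall k, 0 <= u k <= 1) ->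
  0 <= prod_f_R0 u n <= 1.
Proof.
  intros H. induction n as [|n IH]; [apply H|]. rewrite prod_S.
  pose proof (H (S n)). nra.
Qed.

Lemma prod_decr (u : nat -> R) (n m : nat) : (forall k, 0 <= u k <= 1) -> (n <= m)%nat ->
  prod_f_R0 u m <= prod_f_R0 u n.
Proof.
  intros H Hnm. induction Hnm as [|m Hnm IH]; [lra|]. rewrite prod_S.
  pose proof (H (S m)). pose proof (prod_unit_interval u m H). nra.
Qed.

Lemma prod_le_factor (u : nat -> R) (k : nat) : (forall j, 0 <= u j <= 1) -> prod_f_R0 u k <= u k.
Proof.
  intros H. destruct k as [|k]; [simpl; lra|]. rewrite prod_S.
  pose proof (prod_unit_interval u k H). pose proof (H (S k)). nra.
Qed.

Lemma prod_pos (u : nat -> R) (n : nat) : (forall k, 0 < u k) -> 0 < prod_f_R0 u n.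
Proof.
  intros H. induction n as [|n IH]; [apply H|]. rewrite prod_S.
  apply Rmult_lt_0_compat; [assumption | apply H].
Qed.

Lemma prod_sqrt (u : nat -> R) n : (forall k, 0 <= u k) ->
  prod_f_R0 (fun k => sqrt (u k)) n = sqrt (prod_f_R0 u n).
Proof.
  intros H. induction n as [|n IH]; [reflexivity|].
  rewrite !prod_S, IH. symmetry. apply sqrt_mult; [|apply H].
  apply prod_SO_pos. intros; apply H.
Qed.

Lemma prod_cv (u : nat -> R) : (forall k, 0 <= u k <= 1) ->
  exists l : R, is_lim_seq (prod_f_R0 u) l.
Proof.
  intros H. apply ex_finite_lim_seq_decr with 0.
  - intros n. apply prod_decr; [exact H | lia].
  - intros n. now apply prod_unit_interval.
Qed.

Lemma prod_lim_le (u : nat -> R) (l : R) (n : nat) : (forall k, 0 <= u k <= 1) ->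
  is_lim_seq (prod_f_R0 u) l -> l <= prod_f_R0 u n.
Proof.
  intros H Hl.
  apply (is_lim_seq_decr_compare (prod_f_R0 u) l Hl).
  intros m. apply prod_decr; [exact H | lia].
Qed.

Lemma is_lim_seq_le_const (u : nat -> R) (l c : R) : is_lim_seq u l ->
  (exists k, forall n, (k <= n)%nat -> c <= u n) -> c <= l.
Proof.
  intros Hl [k Hk].
  apply (is_lim_seq_le_loc (fun _ => c) u c l).
  - exists k. exact Hk.
  - apply is_lim_seq_const.
  - exact Hl.
Qed.

Lemma prod_pos_factor_pos (u : nat -> R) (p : R) : (forall k, 0 <= u k <= 1) ->
  is_lim_seq (prod_f_R0 u) p -> 0 < p -> forall k, 0 < u k.
Proof.
  intros H Hp Hp0 k. pose proof (prod_lim_le u p k H Hp) as Hk.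
  destruct k as [|k]; [simpl in Hk; lra|]. rewrite prod_S in Hk.
  pose proof (prod_unit_interval u k H). pose proof (H (S k)). nra.
Qed.

Lemma prod_eventually_one (u : nat -> R) (n m : nat) : (forall k, (n < k)%nat -> u k = 1) ->
  (n <= m)%nat -> prod_f_R0 u m = prod_f_R0 u n.
Proof.
  intros H Hm. induction Hm as [|m Hm IH]; [reflexivity|].
  rewrite prod_S, IH, (H (S m)) by lia. ring.
Qed.

Lemma prod_enlarge (u : nat -> R) (n : nat) (q : R) : prod_f_R0 u n < q ->
  exists eps, 0 < eps /\ prod_f_R0 (fun k => u k + eps) n < q.
Proof.
  intros H.
  assert (Hc : continuous (fun e => prod_f_R0 (fun k => u k + e) n) 0).
  { apply continuity_pt_filterlim. clear H. induction n as [|n IH].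
    - simpl. reg.
    - apply continuity_pt_mult; [exact IH|]. reg. }
  destruct (Hc (fun v => v < q)) as [d Hd].
  - apply (open_lt q). rewrite (prod_ext _ u); [exact H|]. intros; ring.
  - pose proof (cond_pos d). exists (d / 2). split; [lra|]. apply (Hd (d / 2)).
    change (Rabs (d / 2 - 0) < d). rewrite Rabs_right; lra.
Qed.

(** The tail of the product of v is at least that of u, namely p / prod u n.  The
    resulting bound does not depend on v: this is the uniform convergence behind
    the continuity of an infinite product in a parameter. *)
Lemma prod_uniform_tail (u v : nat -> R) (p l : R) (n : nat) :
  (forall k, 0 < u k) -> (forall k, u k <= v k <= 1) ->
  is_lim_seq (prod_f_R0 u) p -> is_lim_seq (prod_f_R0 v) l ->
  0 <= prod_f_R0 v n - l <= 1 - p / prod_f_R0 u n.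
Proof.
  intros Hu Huv Hp Hl.
  assert (Hv : forall k, 0 <= v k <= 1) by (intros k; specialize (Hu k); specialize (Huv k); lra).
  assert (Hu1 : forall k, 0 <= u k <= 1) by (intros k; specialize (Hu k); specialize (Huv k); lra).
  pose proof (prod_lim_le v l n Hv Hl) as H1.
  pose proof (prod_pos u n Hu) as HU.
  split; [lra|].
  assert (Hr : forall m, (n <= m)%nat ->
     prod_f_R0 v n / prod_f_R0 u n * prod_f_R0 u m <= prod_f_R0 v m).
  { intros m Hm. induction Hm as [|m Hm IH].
    - right. field. lra.
    - rewrite !prod_S.
      pose proof (prod_pos u m Hu). specialize (Huv (S m)). specialize (Hu (S m)).
      pose proof (prod_unit_interval v m Hv).
      rewrite <- Rmult_assoc. nra. }
  assert (Hp1 : p <= prod_f_R0 u n) by now apply prod_lim_le.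
  pose proof (prod_unit_interval v n Hv) as HV.
  assert (Hlow : prod_f_R0 v n / prod_f_R0 u n * p <= l).
  { apply (is_lim_seq_le_loc (fun m => prod_f_R0 v n / prod_f_R0 u n * prod_f_R0 u m)
             (prod_f_R0 v) (prod_f_R0 v n / prod_f_R0 u n * p) l).
    - exists n. exact Hr.
    - apply (is_lim_seq_scal_l _ (prod_f_R0 v n / prod_f_R0 u n) p Hp).
    - exact Hl. }
  assert (p / prod_f_R0 u n <= 1) by (apply Rle_div_l; lra).
  replace (prod_f_R0 v n / prod_f_R0 u n * p) with (prod_f_R0 v n * (p / prod_f_R0 u n)) in Hlow
    by (field; lra).
  nra.
Qed.

(** The partial products are continuous in a and converge uniformly by
    [prod_uniform_tail], so their limit is continuous in a. *)
Lemma prod_IVT (g : nat -> R -> R) (u : nat -> R) (p r q : R) :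
  (forall k, 0 < u k) -> (forall k a, u k <= g k a <= 1) ->
  (forall k a, continuous (g k) a) -> 0 < p -> is_lim_seq (prod_f_R0 u) p ->
  is_lim_seq (prod_f_R0 (fun k => g k 1)) p -> is_lim_seq (prod_f_R0 (fun k => g k 0)) r ->
  p < q <= r ->
  exists a : R, 0 <= a <= 1 /\ is_lim_seq (prod_f_R0 (fun k => g k a)) q.
Proof.
  intros Hu Hg Hc Hp0 Hp H1 H0 Hq.
  assert (Hex : forall a, is_lim_seq (prod_f_R0 (fun k => g k a))
                            (real (Lim_seq (prod_f_R0 (fun k => g k a))))).
  { intros a. destruct (prod_cv (fun k => g k a)) as [l Hl].
    - intros k. specialize (Hu k); specialize (Hg k a); lra.
    - now rewrite (is_lim_seq_unique _ _ Hl). }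
  set (G := fun a => real (Lim_seq (prod_f_R0 (fun k => g k a)))) in *.
  assert (HG : continuity G).
  { intros a.
    apply (CVU_continuity (fun n a => prod_f_R0 (fun k => g k a) n) G a (mkposreal 1 Rlt_0_1)).
    - intros eps Heps.
      assert (Hlim : is_lim_seq (fun n => 1 - p / prod_f_R0 u n) 0).
      { replace 0 with (1 - p / p) by (field; lra).
        apply is_lim_seq_minus'; [apply is_lim_seq_const|].
        apply is_lim_seq_div'; [apply is_lim_seq_const | exact Hp | lra]. }
      apply is_lim_seq_spec in Hlim. destruct (Hlim (mkposreal eps Heps)) as [N HN].
      exists N. intros n y Hn _. specialize (HN n Hn). simpl in HN.
      pose proof (prod_uniform_tail u (fun k => g k y) p (G y) n Hu
                    (fun k => Hg k y) Hp (Hex y)).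
      rewrite Rminus_0_r in HN. rewrite Rabs_minus_sym, Rabs_right by lra.
      apply Rabs_def2 in HN. lra.
    - intros n y _. induction n as [|n IH]; [apply continuity_pt_filterlim, Hc|].
      apply continuity_pt_mult; [exact IH | apply continuity_pt_filterlim, Hc].
    - unfold Boule. simpl. rewrite Rminus_diag, Rabs_R0. lra. }
  destruct (Req_dec q r) as [->|Hqr]; [exists 0; split; [lra | exact H0]|].
  assert (G1 : G 1 = p) by (unfold G; now rewrite (is_lim_seq_unique _ _ H1)).
  assert (G0 : G 0 = r) by (unfold G; now rewrite (is_lim_seq_unique _ _ H0)).
  destruct (IVT (fun a => q - G a) 0 1) as [a [Ha Haq]].
  - apply continuity_minus; [apply continuity_const; now intros ? ? | exact HG].
  - lra.
  - rewrite G0. lra.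
  - rewrite G1. lra.
  - exists a. split; [exact Ha|]. replace q with (G a) by lra. apply Hex.
Qed.

(** Numbers in (0,1) whose infinite product telescopes to a positive limit:
    telescoping_factor (k+1) is the ratio of (k+4)/(k+3) to (k+3)/(k+2). *)
Definition telescoping_factor (k : nat) : R := (INR k + 1) * (INR k + 3) / (INR k + 2) ^ 2.

Lemma telescoping_factor_bounds k : 0 < telescoping_factor k < 1.
Proof.
  unfold telescoping_factor. pose proof (pos_INR k). split.
  - apply Rdiv_lt_0_compat; nra.
  - apply Rlt_div_l; nra.
Qed.

Lemma prod_telescoping_bound (u : nat -> R) (n m : nat) : (forall k, 0 < u k <= 1) ->
  (forall k, (n < k)%nat -> telescoping_factor k <= u k) -> 
  prod_f_R0 u n / 2 <= prod_f_R0 u m.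
Proof.
  intros Hu Ht.
  assert (Hu0 : forall k, 0 <= u k <= 1) by (intros k; specialize (Hu k); lra).
  pose proof (prod_unit_interval u n Hu0) as Hn.
  destruct (Nat.le_gt_cases m n) as [Hm|Hm].
  { pose proof (prod_decr u m n Hu0 Hm). lra. }
  (* The telescoping factors of index n + 1, ..., m have the product g m / g n,
     which is at least 1/2. *)
  set (g := fun k => (INR k + 3) / (INR k + 2)).
  assert (Hg : forall k, 1 <= g k <= 2).
  { intros k. unfold g. pose proof (pos_INR k). split; [apply Rle_div_r | apply Rle_div_l]; lra. }
  assert (H : forall m, (n <= m)%nat -> prod_f_R0 u n * g m <= prod_f_R0 u m * g n).
  { clear m Hm. intros m Hm. induction Hm as [|m Hm IH]; [lra|]. rewrite prod_S.
    assert (E : g (S m) = g m * telescoping_factor (S m)).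
    { unfold g, telescoping_factor. rewrite S_INR. pose proof (pos_INR m). field. lra. }
    rewrite E. specialize (Ht (S m) ltac:(lia)).
    pose proof (telescoping_factor_bounds (S m)). pose proof (Hg n).
    pose proof (prod_unit_interval u m Hu0).
    apply Rle_trans with (prod_f_R0 u m * g n * telescoping_factor (S m)); [nra|].
    assert (0 <= prod_f_R0 u m * g n) by nra. nra. }
  specialize (H m ltac:(lia)). pose proof (Hg m). pose proof (Hg n).
  pose proof (prod_unit_interval u m Hu0). nra.
Qed.

(** * Lifting families of points of the disc *)

(** The value 1 at the indices that do not count makes a finite product the limit
    of an eventually constant sequence of partial products. *)
Definition modulus (live : nat -> bool) (a : nat -> C) (k : nat) : R :=
  if live k then Cmod (a k) else 1.

Definition in_disc_family (live : nat -> bool) (a : nat -> C) : Prop :=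
  forall k, live k = true -> in_disc (a k).

Definition lifts (live : nat -> bool) (mu eta : nat -> C) : Prop :=
  exists f : C -> C, holomorphic_self_map_of_disc f /\ f 0 = 0 /\
    forall k, live k = true -> f (eta k) = mu k.

Definition attainable (live : nat -> bool) (mu : nat -> C) (q : R) : Prop :=
  exists eta, in_disc_family live eta /\ lifts live mu eta /\
    is_lim_seq (prod_f_R0 (modulus live eta)) q.

Lemma attainable_trans live mu eta (q : R) :
  lifts live mu eta -> attainable live eta q -> attainable live mu q.
Proof.
  intros [f [[Hf Df] [f0 Ef]]] [xi [Hxi [[g [[Hg Dg] [g0 Eg]]] Hq]]].
  exists xi. split; [exact Hxi|]. split; [|exact Hq].
  exists (fun z => f (g z)). split; [split|split].
  - intros z Hz. apply ex_Cderive_comp; [apply Hf; now apply Dg | now apply Hg].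
  - intros z Hz. now apply Df, Dg.
  - now rewrite g0.
  - intros k Hk. now rewrite (Eg k Hk), Ef.
Qed.

Lemma modulus_bounds live a : in_disc_family live a -> forall k, 0 <= modulus live a k <= 1.
Proof.
  intros H k. unfold modulus. destruct (live k) eqn:E; [|lra].
  pose proof (H k E) as Hk. unfold in_disc in Hk. pose proof (Cmod_ge_0 (a k)). lra.
Qed.

Lemma countable_choice_C (live : nat -> bool) (P : nat -> C -> Prop) :
  (forall k, live k = true -> exists z, P k z) ->
  exists a : nat -> C, forall k, live k = true -> P k (a k).
Proof.
  intros H.
  destruct (functional_choice (fun k z => live k = true -> P k z)) as [a Ha].
  - intros k. destruct (live k) eqn:E.
    + destruct (H k E) as [z Hz]. now exists z.
    + now exists 0.
  - now exists a.
Qed.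

(** * Self-maps of degree two *)

Lemma one_plus_neq_0 (a : R) (z : C) : -1 <= a <= 1 -> in_disc z -> (1 + a * z)%C <> 0%C.
Proof.
  intros Ha Hz E. unfold in_disc in Hz.
  assert (Cmod (a * z) = 1).
  { replace (a * z)%C with (- (1))%C by (rewrite <- (Cplus_0_l (- (1))), <- E; ring).
    apply Cmod_m1. }
  rewrite Cmod_mult, Cmod_R in H. pose proof (Cmod_ge_0 z).
  assert (Rabs a <= 1) by (apply Rabs_le; lra). nra.
Qed.

(** The identity showing that z -> (z + a) / (1 + a z) preserves the disc for
    |a| < 1. *)
Lemma Cmod_moebius (a : R) (z : C) :
  Cmod (1 + a * z) ^ 2 - Cmod (z + a) ^ 2 = (1 - a ^ 2) * (1 - Cmod z ^ 2).
Proof. rewrite !Cmod2_alt. destruct z; simpl. ring. Qed.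

(** The map b_a: it is the square for a = 0 and, on the disc, the identity for a = 1. *)
Definition degree_two (a : R) (z : C) : C := (z * (z + a) / (1 + a * z))%C.

Lemma Cmod_degree_two (a : R) (z : C) : 0 <= a <= 1 -> in_disc z ->
  Cmod (degree_two a z) <= Cmod z.
Proof.
  intros Ha Hz. pose proof (one_plus_neq_0 a z ltac:(lra) Hz) as Hd.
  assert (Hp : 0 < Cmod (1 + a * z)) by now apply Cmod_gt_0.
  assert (Cmod (z + a) <= Cmod (1 + a * z)).
  { apply Rsqr_incr_0_var; [|lra]. rewrite !Rsqr_pow2.
    pose proof (Cmod_moebius a z). pose proof (Cmod_ge_0 z). unfold in_disc in Hz.
    assert (0 <= 1 - a ^ 2) by nra. assert (0 <= 1 - Cmod z ^ 2) by nra. nra. }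
  unfold degree_two. rewrite Cmod_div, Cmod_mult by exact Hd.
  apply Rle_div_l; [exact Hp|]. apply Rmult_le_compat_l; [apply Cmod_ge_0 | assumption].
Qed.

Lemma degree_two_self_map (a : R) : 0 <= a <= 1 -> holomorphic_self_map_of_disc (degree_two a).
Proof.
  intros Ha; split; intros z Hz.
  - unfold degree_two.
    apply ex_Cderive_div.
    + apply ex_Cderive_mult.
      * apply (ex_Cderive_affine 0 1). intros; ring.
      * apply (ex_Cderive_affine a 1). intros; ring.
    + now apply (ex_Cderive_affine 1 a).
    + apply one_plus_neq_0; [lra | exact Hz].
  - unfold in_disc. eapply Rle_lt_trans; [apply Cmod_degree_two|]; assumption.
Qed.

Lemma degree_two_0 (a : R) : degree_two a 0 = 0.
Proof. unfold degree_two, Cdiv. ring. Qed.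

(** By the parallelogram law, the sum of the squared moduli of the two roots of
    z^2 + a (1 - mu) z - mu, that is, of the two solutions of b_a(z) = mu, in terms
    of the sum and of the discriminant of the roots.  Unlike the roots, it is
    visibly continuous in a. *)
Definition root_square_sum (mu : C) (a : R) : R :=
  ((a * Cmod (1 - mu)) ^ 2 + Cmod ((a ^ 2)%R * (1 - mu) ^ 2 + 4 * mu)%C) / 2.

(** The squared moduli of the two roots have sum s = root_square_sum mu a and
    product |mu|^2, so the smaller one is (s - sqrt (s^2 - 4 |mu|^2)) / 2. *)
Definition small_root_mod (mu : C) (a : R) : R :=
  sqrt ((root_square_sum mu a - sqrt (root_square_sum mu a ^ 2 - 4 * Cmod mu ^ 2)) / 2).

(** The product of the roots has modulus |mu| < 1, so the smaller root lies in the
    disc. *)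
Lemma small_root (mu : C) (a : R) : in_disc mu -> 0 <= a <= 1 ->
  exists z : C, in_disc z /\ degree_two a z = mu /\ Cmod z = small_root_mod mu a.
Proof.
  intros Hmu Ha. unfold in_disc in *.
  destruct (Csqrt_exists ((a ^ 2)%R * (1 - mu) ^ 2 + 4 * mu)) as [r Hr].
  set (s := (- a * (1 - mu))%C).
  assert (Hs : Cmod s = a * Cmod (1 - mu)).
  { unfold s. rewrite Cmod_mult, Cmod_opp, Cmod_R, Rabs_right by lra. reflexivity. }
  assert (Hsum : Cmod ((s + r) / 2) ^ 2 + Cmod ((s - r) / 2) ^ 2 = root_square_sum mu a).
  { unfold root_square_sum. rewrite <- Hr, <- Hs, Cmod_mult.
    assert (E2 : RtoC 2 <> 0%C) by (intros E%RtoC_inj; lra).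
    rewrite !Cmod_div, Cmod_R, Rabs_right by (exact E2 || lra).
    pose proof (Cmod2_alt (s + r)). pose proof (Cmod2_alt (s - r)).
    pose proof (Cmod2_alt s). pose proof (Cmod2_alt r).
    replace ((Cmod (s + r) / 2) ^ 2) with (Cmod (s + r) ^ 2 / 4) by field.
    replace ((Cmod (s - r) / 2) ^ 2) with (Cmod (s - r) ^ 2 / 4) by field.
    rewrite H, H0. replace (Cmod r * Cmod r) with (Cmod r ^ 2) by ring. rewrite H1, H2.
    destruct s, r; simpl; field. }
  assert (Hprod : Cmod ((s + r) / 2) * Cmod ((s - r) / 2) = Cmod mu).
  { rewrite <- Cmod_mult, <- (Cmod_opp mu). f_equal.
    replace ((s + r) / 2 * ((s - r) / 2))%C with ((s * s - r * r) / 4)%C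
      by field.
    rewrite Hr. unfold s. rewrite RtoC_pow. field. }
  (* The roots are (s + r) / 2 and (s - r) / 2; changing the sign of r makes
     the first one the smaller. *)
  assert (key : forall r, (r * r = (a ^ 2)%R * (1 - mu) ^ 2 + 4 * mu)%C ->
     Cmod ((s + r) / 2) ^ 2 + Cmod ((s - r) / 2) ^ 2 = root_square_sum mu a ->
     Cmod ((s + r) / 2) * Cmod ((s - r) / 2) = Cmod mu ->
     Cmod ((s + r) / 2) <= Cmod ((s - r) / 2) ->
     exists z : C, Cmod z < 1 /\ degree_two a z = mu /\ Cmod z = small_root_mod mu a).
  { clear r Hr Hsum Hprod. intros r Hr Hsum Hprod Hle.
    set (X := Cmod ((s + r) / 2)) in *. set (Y := Cmod ((s - r) / 2)) in *.
    assert (HX : 0 <= X) by apply Cmod_ge_0. assert (HY : 0 <= Y) by apply Cmod_ge_0.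
    assert (HX1 : X < 1) by nra.
    exists ((s + r) / 2)%C. split; [exact HX1|]. split.
    - assert (Hd := one_plus_neq_0 a ((s + r) / 2) ltac:(lra) HX1).
      assert (E : ((s + r) / 2 * ((s + r) / 2) - s * ((s + r) / 2) - mu = 0)%C).
      { replace ((s + r) / 2 * ((s + r) / 2) - s * ((s + r) / 2) - mu)%C
          with ((r * r - s * s) / 4 - mu)%C by field.
        rewrite Hr. unfold s. rewrite RtoC_pow. field. }
      set (z := ((s + r) / 2)%C) in *.
      assert (F : (z * (z + a) = mu * (1 + a * z))%C).
      { replace (z * (z + a))%C with ((z * z - s * z - mu) + mu + (s + a) * z)%C by ring.
        rewrite E. unfold s. ring. }
      unfold degree_two. rewrite F. field. exact Hd.
    - unfold small_root_mod. rewrite <- Hsum.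
      replace ((X ^ 2 + Y ^ 2) ^ 2 - 4 * Cmod mu ^ 2) with ((Y ^ 2 - X ^ 2) ^ 2)
        by (rewrite <- Hprod; ring).
      rewrite sqrt_pow2 by nra.
      replace ((X ^ 2 + Y ^ 2 - (Y ^ 2 - X ^ 2)) / 2) with (X ^ 2) by field.
      symmetry; now apply sqrt_pow2. }
  destruct (Rle_lt_dec (Cmod ((s + r) / 2)) (Cmod ((s - r) / 2))).
  - now apply (key r).
  - apply (key (- r)%C).
    + rewrite <- Hr. ring.
    + replace (s + - r)%C with (s - r)%C by ring. replace (s - - r)%C with (s + r)%C by ring. lra.
    + replace (s + - r)%C with (s - r)%C by ring. replace (s - - r)%C with (s + r)%C by ring. lra.
    + replace (s + - r)%C with (s - r)%C by ring. replace (s - - r)%C with (s + r)%C by ring. lra.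
Qed.

Lemma continuous_Cmod_affine (u v : C) (x : R) : continuous (fun x : R => Cmod (x * u + v)%C) x.
Proof.
  unfold Cmod. apply (continuous_comp _ sqrt); [|apply continuous_sqrt].
  apply (ex_derive_continuous (V := R_NormedModule)). destruct u, v; simpl. auto_derive. trivial.
Qed.

Lemma continuous_small_root_mod (mu : C) (a : R) : continuous (small_root_mod mu) a.
Proof.
  assert (Hs : continuous (root_square_sum mu) a).
  { unfold root_square_sum.
    apply (continuous_mult (K := R_AbsRing)); [|apply continuous_const].
    apply (continuous_plus (V := R_NormedModule)).
    - apply (ex_derive_continuous (V := R_NormedModule)). auto_derive. trivial.
    - apply (continuous_comp (fun x => x ^ 2) (fun x : R => Cmod (x * (1 - mu) ^ 2 + 4 * mu))).
      + apply (ex_derive_continuous (V := R_NormedModule)). auto_derive. trivial.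
      + apply continuous_Cmod_affine. }
  unfold small_root_mod.
  apply (continuous_comp _ sqrt); [|apply continuous_sqrt].
  apply (continuous_mult (K := R_AbsRing)); [|apply continuous_const].
  apply (continuous_minus (V := R_NormedModule)); [exact Hs|].
  apply (continuous_comp _ sqrt); [|apply continuous_sqrt].
  apply (continuous_comp (root_square_sum mu) (fun x => x ^ 2 - 4 * Cmod mu ^ 2)); [exact Hs|].
  apply (ex_derive_continuous (V := R_NormedModule)). auto_derive. trivial.
Qed.

Lemma small_root_mod_0 (mu : C) : small_root_mod mu 0 = sqrt (Cmod mu).
Proof.
  assert (E : root_square_sum mu 0 = 2 * Cmod mu).
  { unfold root_square_sum.
    replace ((0 ^ 2)%R * (1 - mu) ^ 2 + 4 * mu)%C with (4 * mu)%C by (rewrite RtoC_pow; ring).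
    rewrite Cmod_mult, Cmod_R, Rabs_right by lra. field. }
  unfold small_root_mod. rewrite E.
  replace ((2 * Cmod mu) ^ 2 - 4 * Cmod mu ^ 2) with 0 by ring.
  rewrite sqrt_0. f_equal. field.
Qed.

(** For a = 1 the roots are mu and -1. *)
Lemma small_root_mod_1 (mu : C) : in_disc mu -> small_root_mod mu 1 = Cmod mu.
Proof.
  intros Hmu. unfold in_disc in Hmu. pose proof (Cmod_ge_0 mu).
  assert (E : root_square_sum mu 1 = 1 + Cmod mu ^ 2).
  { unfold root_square_sum.
    replace ((1 ^ 2)%R * (1 - mu) ^ 2 + 4 * mu)%C with ((1 + mu) * (1 + mu))%C
      by (rewrite RtoC_pow; ring).
    rewrite Cmod_mult.
    replace (Cmod (1 + mu) * Cmod (1 + mu)) with (Cmod (1 + mu) ^ 2) by ring.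
    rewrite Rmult_1_l, !Cmod2_alt. destruct mu; simpl. field. }
  unfold small_root_mod. rewrite E.
  replace ((1 + Cmod mu ^ 2) ^ 2 - 4 * Cmod mu ^ 2) with ((1 - Cmod mu ^ 2) ^ 2) by ring.
  rewrite sqrt_pow2 by nra.
  replace ((1 + Cmod mu ^ 2 - (1 - Cmod mu ^ 2)) / 2) with (Cmod mu ^ 2) by field.
  now apply sqrt_pow2.
Qed.

(** The lower bound is |b_a(z)| <= |z|, used at the root z. *)
Lemma small_root_mod_bounds mu a : in_disc mu -> 0 <= a <= 1 ->
  Cmod mu <= small_root_mod mu a < 1.
Proof.
  intros Hmu Ha. destruct (small_root mu a Hmu Ha) as [z [Hz [E Em]]].
  rewrite <- Em, <- E. split; [now apply Cmod_degree_two | exact Hz].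
Qed.

Lemma degree_two_lift live mu a : 0 <= a <= 1 -> in_disc_family live mu ->
  exists eta, in_disc_family live eta /\ lifts live mu eta /\
    forall k, live k = true -> Cmod (eta k) = small_root_mod (mu k) a.
Proof.
  intros Ha Hmu.
  destruct (countable_choice_C live (fun k z => in_disc z /\ degree_two a z = mu k /\
     Cmod z = small_root_mod (mu k) a)) as [eta Heta].
  - intros k Hk. apply small_root; auto.
  - exists eta. split; [|split].
    + intros k Hk. now apply Heta.
    + exists (degree_two a). split; [now apply degree_two_self_map|].
      split; [apply degree_two_0|]. intros k Hk. now apply Heta.
    + intros k Hk. now apply Heta.
Qed.

(** * Raising a positive product *)

(** The moduli of the smaller roots of b_a(z) = mu_k have product p at a = 1 and
    sqrt p at a = 0. *)
Lemma raise_to_sqrt live mu (p q : R) : in_disc_family live mu ->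
  is_lim_seq (prod_f_R0 (modulus live mu)) p -> 0 < p -> p < q <= sqrt p ->
  attainable live mu q.
Proof.
  intros Hmu Hp Hp0 Hq.
  (* The projection of the line onto [0,1]: the intermediate value theorem is
     applied to functions that are continuous everywhere. *)
  set (clamp := fun a => (Rabs a - Rabs (a - 1) + 1) / 2).
  assert (Hcl : forall a, 0 <= clamp a <= 1) by (intros a; unfold clamp; split_Rabs; lra).
  assert (Hid : forall a, 0 <= a <= 1 -> clamp a = a)
    by (intros a Ha; unfold clamp; split_Rabs; lra).
  set (g := fun k a => if live k then small_root_mod (mu k) (clamp a) else 1).
  assert (Hu := modulus_bounds live mu Hmu).
  assert (Hex : forall k a, modulus live mu k <= g k a <= 1).
  { intros k a. unfold g, modulus. destruct (live k) eqn:E; [|lra].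
    pose proof (small_root_mod_bounds (mu k) (clamp a) (Hmu k E) (Hcl a)). lra. }
  destruct (prod_IVT g (modulus live mu) p (sqrt p) q) as [a [Ha HGa]]; auto.
  - eapply prod_pos_factor_pos; eauto.
  - intros k a. unfold g. destruct (live k); [|apply continuous_const].
    apply (continuous_comp clamp (small_root_mod (mu k))); [|apply continuous_small_root_mod].
    unfold clamp. apply continuity_pt_filterlim.
    reg; apply Rcontinuity_abs.
  - eapply is_lim_seq_ext; [|exact Hp]. intros n. apply prod_ext. intros k.
    unfold g, modulus. destruct (live k) eqn:E; [|reflexivity].
    rewrite Hid, small_root_mod_1 by (auto; lra). reflexivity.
  - apply is_lim_seq_ext with (fun n => sqrt (prod_f_R0 (modulus live mu) n)).
    + intros n. rewrite <- prod_sqrt by apply Hu. apply prod_ext.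
      intros k. unfold g, modulus. destruct (live k) eqn:E; [|now apply sqrt_1].
      rewrite Hid, small_root_mod_0 by lra. reflexivity.
    + apply is_lim_seq_continuous; [|exact Hp]. apply continuity_pt_sqrt. lra.
  - destruct (degree_two_lift live mu a Ha Hmu) as [eta [Heta [Hl Hm]]].
    exists eta. split; [exact Heta|]. split; [exact Hl|].
    eapply is_lim_seq_ext; [|exact HGa]. intros n. apply prod_ext. intros k.
    unfold g, modulus. destruct (live k) eqn:E; [|reflexivity].
    rewrite Hid, Hm by auto. reflexivity.
Qed.

(** Lifting by the square map replaces p by sqrt p.  Since q < 1, q^(2^n) <= p for
    some n, and each square root lowers n by one. *)
Lemma attainable_of_pos live mu (p q : R) : in_disc_family live mu ->
  is_lim_seq (prod_f_R0 (modulus live mu)) p -> 0 < p -> p < q < 1 ->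
  attainable live mu q.
Proof.
  intros Hmu Hp Hp0 Hq.
  assert (exists n, q ^ (2 ^ n) <= p) as [n Hn].
  { destruct (pow_lt_1_zero q ltac:(rewrite Rabs_right; lra) p Hp0) as [N HN].
    exists N. specialize (HN (2 ^ N)%nat).
    assert (Rabs (q ^ 2 ^ N) < p) by (apply HN; pose proof (Nat.pow_gt_lin_r 2 N); lia).
    pose proof (Rle_abs (q ^ 2 ^ N)). lra. }
  revert mu p Hmu Hp Hp0 Hq Hn. induction n as [|n IH]; intros mu p Hmu Hp Hp0 Hq Hn.
  - simpl in Hn. lra.
  - destruct (Rle_lt_dec q (sqrt p)) as [Hs|Hs]; [now apply (raise_to_sqrt live mu p q)|].
    destruct (degree_two_lift live mu 0 ltac:(lra) Hmu) as [eta [Heta [Hl Hm]]].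
    apply (attainable_trans live mu eta q Hl).
    apply (IH eta (sqrt p)); auto.
    + apply is_lim_seq_ext with (fun m => sqrt (prod_f_R0 (modulus live mu) m)).
      * intros m. rewrite <- prod_sqrt by (now apply modulus_bounds). apply prod_ext.
        intros k. unfold modulus. destruct (live k) eqn:E; [|now apply sqrt_1].
        rewrite Hm, small_root_mod_0 by auto. reflexivity.
      * apply is_lim_seq_continuous; [|exact Hp]. apply continuity_pt_sqrt. lra.
    + now apply sqrt_lt_R0.
    + lra.
    + replace (2 ^ S n)%nat with (2 ^ n * 2)%nat in Hn by (simpl; lia).
      rewrite pow_mult in Hn. rewrite <- (sqrt_pow2 (q ^ 2 ^ n)) by (apply pow_le; lra).
      now apply sqrt_le_1_alt.
Qed.

(** * The universal covering of a punctured disc *)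

Definition disc_involution (c : R) (z : C) : C := ((c - z) / (1 - c * z))%C.

Lemma involution_denom (c : R) (z : C) : -1 <= c <= 1 -> in_disc z -> (1 - c * z)%C <> 0%C.
Proof.
  intros Hc Hz. replace (1 - c * z)%C with (1 + (- c)%R * z)%C by (rewrite RtoC_opp; ring).
  apply one_plus_neq_0; [lra | exact Hz].
Qed.

Lemma disc_involution_in_disc (c : R) (z : C) : -1 < c < 1 -> in_disc z ->
  in_disc (disc_involution c z).
Proof.
  intros Hc Hz. assert (Hd := involution_denom c z ltac:(lra) Hz).
  assert (Hp : 0 < Cmod (1 - c * z)) by now apply Cmod_gt_0.
  unfold in_disc, disc_involution in *. rewrite Cmod_div by exact Hd.
  apply Rlt_div_l; [exact Hp|]. rewrite Rmult_1_l.
  apply Rsqr_incrst_0; [|apply Cmod_ge_0 | lra]. rewrite !Rsqr_pow2.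
  pose proof (Cmod_moebius (- c) z) as H. rewrite RtoC_opp in H.
  replace (1 + - c * z)%C with (1 - c * z)%C in H by ring.
  replace (z + - c)%C with (- (c - z))%C in H by ring. rewrite Cmod_opp in H.
  pose proof (Cmod_ge_0 z).
  assert (0 < (1 - (- c) ^ 2) * (1 - Cmod z ^ 2)) by (apply Rmult_lt_0_compat; nra). lra.
Qed.

Lemma disc_involution_involutive (c : R) (z : C) : -1 < c < 1 -> in_disc z ->
  disc_involution c (disc_involution c z) = z.
Proof.
  intros Hc Hz. assert (Hd := involution_denom c z ltac:(lra) Hz).
  unfold disc_involution. field.
  split; [exact Hd|].
  replace (1 - c * z - c * (c - z))%C with (RtoC (1 - c * c)) by (rewrite RtoC_minus, RtoC_mult; ring).
  intros E%RtoC_inj. nra.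
Qed.

Definition to_half_plane (z : C) : C := ((1 + z) / (1 - z))%C.

Definition of_half_plane (w : C) : C := ((w - 1) / (w + 1))%C.

Lemma Re_to_half_plane (z : C) : in_disc z -> 0 < Re (to_half_plane z).
Proof.
  intros Hz. unfold in_disc in Hz. pose proof (Cmod_ge_0 z). pose proof (Cmod2_alt z) as E.
  unfold to_half_plane, Cdiv. destruct z as [x y]; simpl in *.
  assert (x * x + y * y < 1) by nra.
  assert (x < 1) by nra.
  assert (0 < (1 - x) * (1 - x)) by nra.
  match goal with |- 0 < ?e => replace e with
    ((1 - (x * x + y * y)) / ((1 - x) * (1 - x) + y * y)) by (field; nra) end.
  apply Rdiv_lt_0_compat; nra.
Qed.

Lemma half_plane_neq (w : C) : 0 < Re w -> (w + 1)%C <> 0.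
Proof. intros H E. apply (f_equal Re) in E. destruct w; simpl in *. lra. Qed.

Lemma to_half_plane_of (w : C) : 0 < Re w -> to_half_plane (of_half_plane w) = w.
Proof.
  intros H. pose proof (half_plane_neq w H). unfold to_half_plane, of_half_plane.
  field. split; [assumption|]. ring_simplify (w + 1 - (w - 1))%C. intros E%RtoC_inj. lra.
Qed.

Lemma Cmod_of_half_plane (w : C) : 0 < Re w ->
  Cmod (of_half_plane w) ^ 2 = 1 - 4 * Re w / ((Re w + 1) ^ 2 + Im w ^ 2).
Proof.
  intros H. pose proof (half_plane_neq w H). unfold of_half_plane.
  rewrite Cmod_div by assumption.
  assert (H1 : 0 < Cmod (w + 1)) by now apply Cmod_gt_0.
  replace ((Cmod (w - 1) / Cmod (w + 1)) ^ 2) with (Cmod (w - 1) ^ 2 / Cmod (w + 1) ^ 2)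
    by (field; lra).
  rewrite !Cmod2_alt. destruct w as [x y]; simpl in *. field. nra.
Qed.

Lemma of_half_plane_in_disc (w : C) : 0 < Re w -> in_disc (of_half_plane w).
Proof.
  intros H. pose proof (Cmod_of_half_plane w H) as E.
  assert (0 < 4 * Re w / ((Re w + 1) ^ 2 + Im w ^ 2)) by (apply Rdiv_lt_0_compat; nra).
  unfold in_disc. pose proof (Cmod_ge_0 (of_half_plane w)). nra.
Qed.

Lemma exp_neg_bounds (t : R) : 0 < t -> 0 < exp (- t) < 1.
Proof.
  intros Ht. split; [apply exp_pos|]. rewrite <- exp_0. apply exp_increasing. lra.
Qed.

(** Here to_half_plane maps the disc onto the right half-plane, which w -> exp(-t w)
    maps onto the disc punctured at 0 as a covering; the involution exchanging
    e^{-t} and 0 moves the puncture to e^{-t} and the image of 0 to 0. *)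
Definition punctured_cover (t : R) (z : C) : C :=
  disc_involution (exp (- t)) (Cexp ((- t)%R * to_half_plane z)).

Lemma Cexp_half_plane_in_disc (t : R) (z : C) : 0 < t -> in_disc z ->
  in_disc (Cexp ((- t)%R * to_half_plane z)).
Proof.
  intros Ht Hz. pose proof (Re_to_half_plane z Hz) as H.
  unfold in_disc. rewrite Cmod_Cexp, <- exp_0. apply exp_increasing.
  destruct (to_half_plane z); simpl in *. nra.
Qed.

Lemma punctured_cover_self_map (t : R) : 0 < t -> holomorphic_self_map_of_disc (punctured_cover t).
Proof.
  intros Ht. pose proof (exp_neg_bounds t Ht).
  split; intros z Hz.
  - unfold punctured_cover.
    apply (ex_Cderive_comp (disc_involution (exp (- t)))
             (fun z => Cexp ((- t)%R * to_half_plane z))).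
    + unfold disc_involution. apply ex_Cderive_div.
      * apply (ex_Cderive_affine (exp (- t)) (- (1))%C). intros; ring.
      * apply (ex_Cderive_affine 1 (- exp (- t))%C). intros; ring.
      * apply involution_denom; [lra|]. now apply Cexp_half_plane_in_disc.
    + apply (ex_Cderive_comp Cexp); [apply ex_Cderive_exp|].
      apply ex_Cderive_mult; [apply (ex_Cderive_affine (- t)%R 0); intros; ring|].
      unfold to_half_plane. apply ex_Cderive_div.
      * apply (ex_Cderive_affine 1 1). intros; ring.
      * apply (ex_Cderive_affine 1 (- (1))%C). intros; ring.
      * replace (1 - z)%C with (1 - 1 * z)%C by ring. apply involution_denom; [lra | exact Hz].
  - apply disc_involution_in_disc; [lra|]. now apply Cexp_half_plane_in_disc.
Qed.

Lemma punctured_cover_0 (t : R) : punctured_cover t 0 = 0.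
Proof.
  unfold punctured_cover.
  replace (Cexp ((- t)%R * to_half_plane 0)) with (RtoC (exp (- t))).
  - unfold disc_involution, Cdiv. ring.
  - replace ((- t)%R * to_half_plane 0)%C with (RtoC (- t)) by (unfold to_half_plane; field).
    unfold Cexp, RtoC; simpl. rewrite cos_0, sin_0. f_equal; ring.
Qed.

(** Each logarithm of the image of mu under the involution yields a preimage of
    mu.  Its real part is negative because that image lies in the disc. *)
Lemma punctured_cover_preimage (t : R) (mu L : C) : 0 < t -> in_disc mu ->
  Cexp L = disc_involution (exp (- t)) mu ->
  0 < Re ((- / t)%R * L) /\ punctured_cover t (of_half_plane ((- / t)%R * L)) = mu.
Proof.
  intros Ht Hmu HL. pose proof (exp_neg_bounds t Ht) as Hc.
  assert (HR : Re L < 0).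
  { apply exp_lt_inv. rewrite exp_0, <- Cmod_Cexp, HL.
    apply disc_involution_in_disc; [lra | exact Hmu]. }
  assert (HW : 0 < Re ((- / t)%R * L)).
  { destruct L as [x y]; simpl in *. pose proof (Rinv_0_lt_compat t Ht). nra. }
  split; [exact HW|]. unfold punctured_cover. rewrite to_half_plane_of by exact HW.
  replace ((- t)%R * ((- / t)%R * L))%C with L.
  - rewrite HL. apply disc_involution_involutive; [lra | exact Hmu].
  - rewrite Cmult_assoc, <- RtoC_mult. replace (- t * - / t) with 1 by (field; lra). ring.
Qed.

(** The logarithms of a nonzero number form a vertical progression, and a point
    going to infinity along a vertical line of the half-plane corresponds to a
    point of the disc tending to the circle. *)
Lemma punctured_cover_near_boundary (t rho : R) (mu : C) : 0 < t -> in_disc mu ->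
  mu <> RtoC (exp (- t)) -> 0 < rho < 1 ->
  exists z, in_disc z /\ punctured_cover t z = mu /\ rho <= Cmod z.
Proof.
  intros Ht Hmu Hne Hrho. pose proof (exp_neg_bounds t Ht) as Hc.
  assert (Hv : disc_involution (exp (- t)) mu <> 0).
  { intros E. apply Hne. rewrite <- (disc_involution_involutive (exp (- t)) mu), E by (lra || assumption).
    unfold disc_involution. field. }
  destruct (Cexp_surj _ Hv) as [L HL].
  (* x is the common real part of the half-plane coordinates of all preimages,
     and K is such that an ordinate y with y^2 >= K gives a modulus of at
     least rho. *)
  set (x := Re ((- / t)%R * L)). set (K := 4 * x / (1 - rho ^ 2)).
  assert (Hr2 : 0 < 1 - rho ^ 2) by nra.
  destruct (INR_unbounded (t * (K + 1) + Rabs (Im L))) as [n Hn].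
  set (L' := (Re L, Im L + 2 * INR n * PI) : C).
  destruct (punctured_cover_preimage t mu L' Ht Hmu) as [HW HE].
  { unfold L'. now rewrite Cexp_periodic. }
  exists (of_half_plane ((- / t)%R * L')).
  split; [now apply of_half_plane_in_disc|]. split; [exact HE|].
  pose proof (Cmod_of_half_plane _ HW) as HM.
  assert (HRe : Re ((- / t)%R * L') = x) by (unfold x, L'; destruct L; simpl; ring).
  rewrite HRe in *.
  set (y := Im ((- / t)%R * L')) in *.
  assert (HK : 0 < K) by (apply Rdiv_lt_0_compat; lra).
  assert (Hy : K + 1 <= - y).
  { assert (Ey : - y = (Im L + 2 * INR n * PI) / t) by (unfold y, L'; destruct L; simpl; field; lra).
    rewrite Ey. apply Rle_div_r; [exact Ht|].
    pose proof PI2_1. pose proof (pos_INR n). pose proof (Rle_abs (- Im L)) as HA.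
    rewrite Rabs_Ropp in HA. nra. }
  assert (HQ : 4 * x / ((x + 1) ^ 2 + y ^ 2) <= 1 - rho ^ 2).
  { apply Rle_div_l; [nra|].
    assert (4 * x = K * (1 - rho ^ 2)) by (unfold K; field; lra).
    assert (K <= (x + 1) ^ 2 + y ^ 2) by nra. nra. }
  pose proof (Cmod_ge_0 (of_half_plane ((- / t)%R * L'))). nra.
Qed.

Lemma difference_quotient_continuous (f : R -> R) (l : R) : is_derive f 0 l -> f 0 = 0 ->
  continuous (fun t => if Req_EM_T t 0 then l else f t / t) 0.
Proof.
  intros Hd H0. apply filterlim_locally. intros eps.
  destruct (real_derive_0 f l Hd (eps / 2)) as [d [Hdp Hb]].
  { pose proof (cond_pos eps). lra. }
  exists (mkposreal d Hdp). intros t Ht.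
  change (Rabs (t - 0) < d) in Ht. rewrite Rminus_0_r in Ht.
  change (Rabs ((if Req_EM_T t 0 then l else f t / t)
            - (if Req_EM_T 0 0 then l else f 0 / 0)) < eps).
  destruct (Req_EM_T 0 0) as [_|?]; [|lra].
  pose proof (cond_pos eps).
  destruct (Req_EM_T t 0) as [_|Hn]; [rewrite Rminus_diag, Rabs_R0; lra|].
  specialize (Hb t Ht). rewrite H0, Rminus_0_r in Hb.
  assert (0 < Rabs t) by now apply Rabs_pos_lt.
  replace (f t / t - l) with ((f t - t * l) / t) by (field; exact Hn).
  rewrite Rabs_div by exact Hn. apply Rlt_div_l; nra.
Qed.

(** For small t both e^{-t} - mu and 1 - e^{-t} mu lie in the right half-plane.  With
    L(t) the difference of their principal logarithms, -L(t)/t is the half-plane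
    coordinate of a preimage of mu.  As L(0) = 0, this tends to
    -L'(0) = (1 + mu) / (1 - mu), the half-plane coordinate of mu itself. *)
Lemma punctured_cover_small_time (mu : C) (rho : R) : in_disc mu -> Cmod mu < rho ->
  at_right 0 (fun t => exists z, in_disc z /\ punctured_cover t z = mu /\ Cmod z < rho).
Proof.
  intros Hmu Hrho. unfold in_disc in Hmu. pose proof (Cmod_ge_0 mu) as Hm0.
  destruct mu as [a b]. pose proof (Cmod2_alt (a, b)) as Hsq.
  set (m := Cmod (a, b)) in *. simpl Re in Hsq. simpl Im in Hsq.
  assert (Hab : a ^ 2 + b ^ 2 < 1) by nra.
  assert (Ha : a < 1) by nra.
  set (L := fun t => (half_plane_log ((exp (- t))%R - (a, b))
                       - half_plane_log (1 - (exp (- t))%R * (a, b)))%C).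
  set (D := (1 - a) ^ 2 + b ^ 2).
  assert (HD : 0 < D) by (unfold D; nra).
  set (x0 := (1 - a ^ 2 - b ^ 2) / D). set (y0 := 2 * b / D).
  assert (HX : is_derive (fun t => - Re (L t)) 0 x0).
  { unfold L, half_plane_log; simpl. auto_derive; rewrite Ropp_0, exp_0.
    - repeat split; nra.
    - unfold x0. unfold D in *. field. repeat split; nra. }
  assert (HY : is_derive (fun t => - Im (L t)) 0 y0).
  { unfold L, half_plane_log; simpl. auto_derive; rewrite Ropp_0, exp_0.
    - repeat split; nra.
    - unfold y0. unfold D in *. field. repeat split; nra. }
  assert (HX0 : - Re (L 0) = 0).
  { unfold L. rewrite Ropp_0, exp_0. replace (1 - 1 * (a, b))%C with (1 - (a, b))%C by ring.
    unfold Cminus at 1. rewrite Cplus_opp_r. simpl. ring. }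
  assert (HY0 : - Im (L 0) = 0).
  { unfold L. rewrite Ropp_0, exp_0. replace (1 - 1 * (a, b))%C with (1 - (a, b))%C by ring.
    unfold Cminus at 1. rewrite Cplus_opp_r. simpl. ring. }
  (* The half-plane coordinates of the preimage, completed by their limits at
     t = 0. *)
  set (x := fun t => if Req_EM_T t 0 then x0 else - Re (L t) / t).
  set (y := fun t => if Req_EM_T t 0 then y0 else - Im (L t) / t).
  assert (Cx : continuity_pt x 0)
    by (apply continuity_pt_filterlim, difference_quotient_continuous; assumption).
  assert (Cy : continuity_pt y 0)
    by (apply continuity_pt_filterlim, difference_quotient_continuous; assumption).
  (* phi t < 0 says that the point of the disc with half-plane coordinate
     (x t, y t) has modulus less than rho. *)
  set (phi := fun t => (1 - rho ^ 2) * ((x t + 1) * (x t + 1) + y t * y t) - 4 * x t).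
  assert (Cphi : continuity_pt phi 0).
  { unfold phi.
    repeat first [apply continuity_pt_minus | apply continuity_pt_plus | apply continuity_pt_mult
      | exact Cx | exact Cy | apply continuity_pt_const; intros ? ?; reflexivity]. }
  assert (Hphi0 : phi 0 < 0).
  { unfold phi, x, y. destruct (Req_EM_T 0 0) as [_|?]; [|lra].
    replace ((1 - rho ^ 2) * ((x0 + 1) * (x0 + 1) + y0 * y0) - 4 * x0)
      with (- (4 * ((rho ^ 2 - m ^ 2) / D))).
    - assert (0 < (rho ^ 2 - m ^ 2) / D) by (apply Rdiv_lt_0_compat; nra). lra.
    - rewrite Hsq. unfold x0, y0. unfold D in *. field. lra. }
  apply continuity_pt_filterlim in Cphi.
  assert (H1 : locally 0 (fun t => phi t < 0)) by (apply (Cphi (fun v => v < 0)), (open_lt 0), Hphi0).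
  assert (Ce : continuous (fun t => exp (- t)) 0).
  { apply (ex_derive_continuous (V := R_NormedModule)). auto_derive. trivial. }
  assert (H2 : locally 0 (fun t => a < exp (- t))).
  { apply (Ce (fun v => a < v)), (open_gt a). rewrite Ropp_0, exp_0. exact Ha. }
  change (locally 0 (fun t => 0 < t -> exists z, in_disc z /\
            punctured_cover t z = (a, b) /\ Cmod z < rho)).
  generalize (filter_and _ _ H1 H2). apply filter_imp. intros t [Hphi Hat] Ht.
  pose proof (exp_neg_bounds t Ht) as Hc.
  assert (HL : Cexp (L t) = disc_involution (exp (- t)) (a, b)).
  { assert (Hn : (1 - (exp (- t))%R * (a, b))%C <> 0) by (apply involution_denom; [lra | exact Hmu]).
    unfold disc_involution.
    rewrite <- (Cexp_half_plane_log ((exp (- t))%R - (a, b))) by (simpl; lra).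
    rewrite <- (Cexp_half_plane_log (1 - (exp (- t))%R * (a, b))) at 1 by (simpl; nra).
    pose proof (Cexp_neq_0 (half_plane_log (1 - (exp (- t))%R * (a, b)))) as Hn'.
    replace (half_plane_log ((exp (- t))%R - (a, b)))
      with (L t + half_plane_log (1 - (exp (- t))%R * (a, b)))%C by (unfold L; ring).
    rewrite Cexp_plus. field. exact Hn'. }
  destruct (punctured_cover_preimage t (a, b) (L t) Ht Hmu HL) as [HW HE].
  exists (of_half_plane ((- / t)%R * L t)).
  split; [now apply of_half_plane_in_disc|]. split; [exact HE|].
  pose proof (Cmod_of_half_plane _ HW) as HM.
  assert (Ex : Re ((- / t)%R * L t) = x t).
  { unfold x. destruct (Req_EM_T t 0); [lra|]. destruct (L t); simpl. field. lra. }
  assert (Ey : Im ((- / t)%R * L t) = y t).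
  { unfold y. destruct (Req_EM_T t 0); [lra|]. destruct (L t); simpl. field. lra. }
  rewrite Ex, Ey in *.
  assert (1 - rho ^ 2 < 4 * x t / ((x t + 1) ^ 2 + y t ^ 2)).
  { apply Rlt_div_r; [nra|]. unfold phi in Hphi. nra. }
  pose proof (Cmod_ge_0 (of_half_plane ((- / t)%R * L t))). nra.
Qed.

Lemma punctured_cover_small_time_finite live mu (rho : nat -> R) (n : nat) :
  in_disc_family live mu -> (forall k, live k = true -> Cmod (mu k) < rho k) ->
  at_right 0 (fun t => forall k, (k <= n)%nat -> live k = true ->
    exists z, in_disc z /\ punctured_cover t z = mu k /\ Cmod z < rho k).
Proof.
  intros Hmu Hrho.
  assert (H1 : forall k, at_right 0 (fun t => live k = true ->
     exists z, in_disc z /\ punctured_cover t z = mu k /\ Cmod z < rho k)).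
  { intros k. destruct (live k) eqn:E.
    - generalize (punctured_cover_small_time (mu k) (rho k) (Hmu k E) (Hrho k E)).
      apply filter_imp. auto.
    - apply filter_forall. discriminate. }
  induction n as [|n IH].
  - generalize (H1 0%nat). apply filter_imp. intros t Ht k Hk.
    replace k with 0%nat by lia. exact Ht.
  - generalize (filter_and _ _ IH (H1 (S n))). apply filter_imp.
    intros t [Ht Ht'] k Hk. destruct (Nat.eq_dec k (S n)) as [->|Hn]; [exact Ht'|].
    apply Ht. lia.
Qed.

(** * Making the product positive *)

(** One point lifted to -a is enough to bound the whole product by a. *)
Lemma lift_to_nonzero live mu (p q : R) : in_disc_family live mu ->
  is_lim_seq (prod_f_R0 (modulus live mu)) p -> p < q ->
  exists eta, in_disc_family live eta /\ lifts live mu eta /\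
    (forall k, live k = true -> eta k <> 0) /\
    exists p' : R, is_lim_seq (prod_f_R0 (modulus live eta)) p' /\ p' < q.
Proof.
  intros Hmu Hp Hq.
  assert (Hq0 : 0 < q).
  { apply Rle_lt_trans with p; [|exact Hq]. apply (is_lim_seq_le_const _ p 0 Hp).
    exists 0%nat. intros n _. apply prod_unit_interval. now apply modulus_bounds. }
  destruct (classic (exists k, live k = true /\ mu k = 0)) as [[k0 [Hk0 Hz]]|Hnz].
  - set (a := Rmin (1 / 2) (q / 2)).
    assert (Ha : 0 < a) by (apply Rmin_glb_lt; lra).
    assert (Ha1 : a <= 1 / 2) by apply Rmin_l.
    assert (Ha2 : a <= q / 2) by apply Rmin_r.
    destruct (countable_choice_C live (fun k z => in_disc z /\ degree_two a z = mu k /\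
       z <> 0 /\ (mu k = 0 -> Cmod z = a))) as [eta Heta].
    { intros k Hk. destruct (Ceq_dec (mu k) 0) as [E|E].
      - exists (- a)%C.
        assert (Hm : Cmod (- a) = a) by (rewrite Cmod_opp, Cmod_R, Rabs_right; lra).
        split; [unfold in_disc; lra|]. split.
        + rewrite E. unfold degree_two, Cdiv. ring.
        + split; [apply Cmod_gt_0; lra | auto].
      - destruct (small_root (mu k) a (Hmu k Hk)) as [z [Hzd [Hzm _]]]; [lra|].
        exists z. split; [exact Hzd|]. split; [exact Hzm|]. split; [|tauto].
        intros ->. apply E. rewrite <- Hzm. apply degree_two_0. }
    assert (Hd : in_disc_family live eta) by (intros k Hk; now apply Heta).
    destruct (prod_cv (modulus live eta) (modulus_bounds live eta Hd)) as [p' Hp'].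
    exists eta. split; [exact Hd|]. split; [|split].
    + exists (degree_two a). split; [apply degree_two_self_map; lra|].
      split; [apply degree_two_0|]. intros k Hk. now apply Heta.
    + intros k Hk. now apply Heta.
    + exists p'. split; [exact Hp'|].
      assert (H1 := prod_lim_le _ p' k0 (modulus_bounds live eta Hd) Hp').
      assert (H2 := prod_le_factor _ k0 (modulus_bounds live eta Hd)).
      unfold modulus at 2 in H2. rewrite Hk0 in H2.
      destruct (Heta k0 Hk0) as [_ [_ [_ H3]]]. rewrite (H3 Hz) in H2. lra.
  - exists mu. split; [exact Hmu|]. split; [|split].
    + exists (fun z => z). split; [split|split]; auto.
      intros z _. apply (ex_Cderive_affine 0 1). intros; ring.
    + intros k Hk E. apply Hnz. now exists k.
    + now exists p.
Qed.

(** The first n + 1 points are lifted almost without change, so that the product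
    stays below q; the moduli of the others are kept above telescoping factors, so
    that it stays positive. *)
Lemma lift_to_positive live mu (p q : R) : in_disc_family live mu ->
  (forall k, live k = true -> mu k <> 0) ->
  is_lim_seq (prod_f_R0 (modulus live mu)) p -> p < q ->
  exists eta, in_disc_family live eta /\ lifts live mu eta /\
    exists p' : R, is_lim_seq (prod_f_R0 (modulus live eta)) p' /\ 0 < p' < q.
Proof.
  intros Hmu Hnz Hp Hq.
  assert (exists n, prod_f_R0 (modulus live mu) n < q) as [n Hn].
  { apply is_lim_seq_spec in Hp. destruct (Hp (mkposreal (q - p) ltac:(lra))) as [n Hn].
    exists n. specialize (Hn n (Nat.le_refl n)). simpl in Hn. apply Rabs_def2 in Hn. lra. }
  destruct (prod_enlarge _ n q Hn) as [eps [Heps Hprod]].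
  destruct (punctured_cover_small_time_finite live mu (fun k => Cmod (mu k) + eps) n Hmu)
    as [T HT].
  { intros. lra. }
  (* exp (- t) = mu k forces t = - ln (Re (mu k)). *)
  destruct (avoid_sequence (fun k => - ln (Re (mu k))) T (cond_pos T)) as [t [Ht Hav]].
  assert (HTt : forall k, (k <= n)%nat -> live k = true ->
    exists z, in_disc z /\ punctured_cover t z = mu k /\ Cmod z < Cmod (mu k) + eps).
  { apply HT; [|lra]. change (Rabs (t - 0) < T). rewrite Rabs_right; lra. }
  destruct (countable_choice_C live (fun k z => in_disc z /\ punctured_cover t z = mu k /\
     ((k <= n)%nat -> Cmod z < Cmod (mu k) + eps) /\
     ((n < k)%nat -> telescoping_factor k <= Cmod z))) as [eta Heta].
  { intros k Hk. destruct (Nat.le_gt_cases k n) as [Hkn|Hkn].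
    - destruct (HTt k Hkn Hk) as [z [H1 [H2 H3]]]. exists z. repeat split; auto. lia.
    - destruct (punctured_cover_near_boundary t (telescoping_factor k) (mu k))
        as [z [H1 [H2 H3]]].
      + apply Ht.
      + now apply Hmu.
      + intros E. apply (Hav k). rewrite E. simpl. rewrite ln_exp. ring.
      + apply telescoping_factor_bounds.
      + exists z. repeat split; auto. lia. }
  assert (Hd : in_disc_family live eta) by (intros k Hk; now apply Heta).
  assert (Hb := modulus_bounds live eta Hd).
  assert (Hpos : forall k, 0 < modulus live eta k <= 1).
  { intros k. split; [|apply Hb]. unfold modulus. destruct (live k) eqn:Hk; [|lra].
    apply Cmod_gt_0. intros E. destruct (Heta k Hk) as [_ [H _]].
    apply (Hnz k Hk). now rewrite <- H, E, punctured_cover_0. }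
  destruct (prod_cv (modulus live eta) Hb) as [p' Hp'].
  exists eta. split; [exact Hd|]. split.
  { exists (punctured_cover t). split; [now apply punctured_cover_self_map|].
    split; [apply punctured_cover_0|]. intros k Hk. now apply Heta. }
  exists p'. split; [exact Hp'|]. split.
  - apply Rlt_le_trans with (prod_f_R0 (modulus live eta) n / 2).
    + pose proof (prod_pos (modulus live eta) n (fun k => proj1 (Hpos k))). lra.
    + apply (is_lim_seq_le_const _ p' _ Hp'). exists 0%nat. intros m _.
      apply prod_telescoping_bound; [exact Hpos|].
      intros k Hk. unfold modulus. destruct (live k) eqn:E.
      * now apply (Heta k E).
      * pose proof (telescoping_factor_bounds k). lra.
  - eapply Rle_lt_trans; [apply (prod_lim_le _ p' n Hb Hp')|].
    eapply Rle_lt_trans; [|exact Hprod].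
    apply prod_SO_Rle. intros k Hk. split; [apply Hb|].
    unfold modulus. destruct (live k) eqn:E; [|lra].
    left. now apply (Heta k E).
Qed.

Lemma attainable_above live mu (p q : R) : in_disc_family live mu ->
  is_lim_seq (prod_f_R0 (modulus live mu)) p -> p < q < 1 -> attainable live mu q.
Proof.
  intros Hmu Hp Hq.
  destruct (lift_to_nonzero live mu p q Hmu Hp ltac:(lra))
    as [eta [Heta [Hl [Hnz [p1 [Hp1 Hq1]]]]]].
  destruct (lift_to_positive live eta p1 q Heta Hnz Hp1 Hq1)
    as [xi [Hxi [Hl' [p2 [Hp2 Hq2]]]]].
  apply (attainable_trans live mu eta q Hl), (attainable_trans live eta xi q Hl').
  apply (attainable_of_pos live xi p2 q); auto; lra.
Qed.

(** * Finite and infinite lists *)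

Definition live_index (N : natbar) (k : nat) : bool :=
  match N with nfin n => Nat.ltb k n | ninf => true end.

Lemma live_index_spec N k : live_index N k = true <-> is_index N (S k).
Proof.
  unfold is_index. destruct N as [n|]; simpl; [rewrite Nat.ltb_lt|]; split; lia || auto with arith.
Qed.

Lemma is_mod_prod_live N a (p : R) : le_natbar 1 N ->
  is_mod_prod N a p <->
  is_lim_seq (prod_f_R0 (modulus (live_index N) (fun k => a (S k)))) p.
Proof.
  intros HN. destruct N as [n|]; simpl in *; [|reflexivity].
  set (u := modulus (live_index (nfin n)) (fun k => a (S k))).
  assert (E : prod_f_R0 u (pred n) = partial_mod_prod a (pred n)).
  { unfold partial_mod_prod.
    assert (H : forall m, (m < n)%nat ->
      prod_f_R0 u m = prod_f_R0 (fun k => Cmod (a (S k))) m).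
    { assert (Hu : forall m, (m < n)%nat -> u m = Cmod (a (S m))).
      { intros m Hm. unfold u, modulus. simpl. now apply Nat.ltb_lt in Hm as ->. }
      intros m Hm. induction m as [|m IH]; [now apply Hu|].
      rewrite !prod_S, IH, Hu by lia. reflexivity. }
    apply H. lia. }
  assert (Hl : is_lim_seq (prod_f_R0 u) (partial_mod_prod a (pred n))).
  { rewrite <- E. apply is_lim_seq_ext_loc with (fun _ => prod_f_R0 u (pred n)).
    - exists (pred n). intros m Hm. symmetry. apply prod_eventually_one; [|exact Hm].
      intros k Hk. unfold u, modulus. simpl. destruct (Nat.ltb_spec k n); [lia | reflexivity].
    - apply is_lim_seq_const. }
  split; [intros ->; exact Hl|].
  intros Hp. apply is_lim_seq_unique in Hp. apply is_lim_seq_unique in Hl.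
  rewrite Hp in Hl. now injection Hl.
Qed.

Theorem lemma4 :
  forall (N : natbar) (HN : le_natbar 1 N)
    (mu : nat -> C) (Hmu : forall j : nat, is_index N j -> in_disc (mu j))
    (p : R) (Hp : is_mod_prod N mu p)
    (q : R) (Hq : (p < q < 1)%R),
  exists (f : C -> C) (eta : nat -> C),
    holomorphic_self_map_of_disc f /\
    (forall j : nat, is_index N j -> in_disc (eta j)) /\
    is_mod_prod N eta q /\
    f (RtoC 0) = RtoC 0 /\
    (forall j : nat, is_index N j -> f (eta j) = mu j).
Proof.
  intros N HN mu Hmu p Hp q Hq.
  destruct (attainable_above (live_index N) (fun k => mu (S k)) p q)
    as [eta [Heta [[f [Hf [f0 Hfe]]] Hlim]]]; [|now apply is_mod_prod_live|exact Hq|].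
  { intros k Hk. now apply Hmu, live_index_spec. }
  exists f, (fun j => eta (pred j)). split; [exact Hf|]. split; [|split; [|split]].
  - intros [|j] Hj; [now destruct Hj|]. now apply Heta, live_index_spec.
  - now apply is_mod_prod_live.
  - exact f0.
  - intros [|j] Hj; [now destruct Hj|]. now apply Hfe, live_index_spec.
Qed.
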